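(* Let $p_0,p_1,q_0,q_1\in(0,1)$. For $i\in\{0,1\}$ and $x\in[0,1]$ set $$f_{i,0}(x)=p_i x,\quad f_{i,1}(x)=(1-p_i)x+p_i,\qquad g_{i,0}(x)=q_i x,\quad g_{i,1}(x)=(1-q_i)x+q_i .$$ Let $(\varphi_0,\varphi_1)$ be the pair of increasing continuous maps $\varphi_0,\varphi_1:[0,1]\to[0,1]$ solving $$g_{i,j}(\varphi_j(x))=\varphi_i(f_{i,j}(x)),\qquad x\in[0,1],\ i,j\in\{0,1\}.$$ (i) If $p_0\neq q_0$ or $p_1\neq q_1$, then both $\varphi_0$ and $\varphi_1$ are singular. (ii) If $p_0=q_0$ and $p_1=q_1$, then $\varphi_i(x)=x$ for all $x\in[0,1]$ and $i\in\{0,1\}$.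
   Context: A function $\varphi$ on $[0,1]$ is called singular if $\varphi'(x)=0$ for Lebesgue-a.e. $x\in(0,1)$. ''Increasing'' is meant in the non-strict sense. A comparison function is an increasing map $\phi:[0,\infty)\to[0,\infty)$ such that $\lim_{n\to\infty}\phi^n(t)=0$ for every $t>0$ ($\phi^n$ is the $n$-fold iterate). A map $h:[0,1]\to[0,1]$ is a $\phi$-contraction if $|h(x)-h(y)|\le\phi(|x-y|)$ for all $x,y\in[0,1]$. A family $\{h_{i,j}\}_{i,j\in\{0,1\}}$ of maps on $[0,1]$ is a compatible system with comparison function $\phi$ if each $h_{i,j}$ is a strictly increasing $\phi$-contraction and $0=h_{i,0}(0)<h_{i,0}(1)=h_{i,1}(0)<h_{i,1}(1)=1$ for $i\in\{0,1\}$. Given two compatible systems $\{f_{i,j}\}$, $\{g_{i,j}\}$ with a common comparison function (as is the case for the affine systems in the claim), the solution $(\varphi_0,\varphi_1)$ is constructed as follows. For $i_1,\dots,i_n\in\{0,1\}$ and $h\in\{f,g\}$ let $I^h_i(i_1,\dots,i_n)$ be the closed interval with endpoints $h_{i,i_1}\circ h_{i_1,i_2}\circ\cdots\circ h_{i_{n-1},i_n}(0)$ and $h_{i,i_1}\circ\cdots\circ h_{i_{n-1},i_n}(1)$. For $x_n\in\{0,1\}$ put $\varphi_i(f_{i,i_1}\circ\cdots\circ f_{i_{n-1},i_n}(x_n))=g_{i,i_1}\circ\cdots\circ g_{i_{n-1},i_n}(x_n)$; for any other $x\in[0,1]$ there is a unique sequence $(i_n)_n$ with $x\in I^f_i(i_1,\dots,i_n)$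 for all $n$, and $\varphi_i(x)$ is the unique point of $\bigcap_{n\ge1}I^g_i(i_1,\dots,i_n)$. It is known that this is well-defined and that $(\varphi_0,\varphi_1)$ is the unique pair of increasing continuous maps $[0,1]\to[0,1]$ satisfying $g_{i,j}\circ\varphi_j=\varphi_i\circ f_{i,j}$ for all $i,j\in\{0,1\}$. *)

(* Defs.v *)
From mathcomp Require Import all_boot all_order all_algebra.
From mathcomp Require Import all_classical all_reals all_analysis.
Set Implicit Arguments.
Unset Strict Implicit.
Unset Printing Implicit Defensive.
Import Order.TTheory GRing.Theory Num.Theory numFieldNormedType.Exports.
Local Open Scope classical_set_scope.
Local Open Scope ring_scope.

(* The index set {0,1} is [bool], with [false] for 0 and [true] for 1.
   Maps on [0,1] are functions [R -> R] constrained on `[0, 1] only. *)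

Definition affine_system (R : realType) (p : bool -> R) (i j : bool) (x : R) : R :=
  if j then (1 - p i) * x + p i else p i * x.

Definition increasing_continuous_self_map (R : realType) (phi : R -> R) : Prop :=
  [/\ {in `[0, 1] &, {homo phi : x y / x <= y}},
      {within `[0, 1], continuous phi} &
      {in `[0, 1], forall x, phi x \in `[0, 1]}].

Definition conjugacy_solution (R : realType) (f g : bool -> bool -> R -> R)
    (phi : bool -> R -> R) : Prop :=
  (forall i, increasing_continuous_self_map (phi i)) /\
  (forall i j, {in `[0, 1], forall x, g i j (phi j x) = phi i (f i j x)}).

(* [is_derive x 1 phi 0] includes the existence of the derivative at x; as x is
   interior to [0,1], it does not depend on the values of phi outside [0,1]. *)
Definition singular (R : realType) (phi : R -> R) : Prop :=
  {ae (@lebesgue_measure R), forall x : R, x \in `]0, 1[ -> is_derive x (1 : R) phi (0 : R)}.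

(* Main.v *)
Require Import Defs.
From mathcomp Require Import all_boot all_order all_algebra.
From mathcomp Require Import all_classical all_reals all_analysis.
From mathcomp Require Import ring lra.
Set Implicit Arguments.
Unset Strict Implicit.
Import Order.TTheory GRing.Theory Num.Theory numFieldNormedType.Exports.
Local Open Scope classical_set_scope.
Local Open Scope ring_scope.

(* Where phi is not flat at scale t, some interval [u, v] around the point has
   phi v - phi u > t (v - u).  By Vitali's covering lemma, the part of this bad
   set inside [a, b] has outer measure at most (5/t) (phi b - phi a), and
   trivially at most b - a, hence at most a constant times
   sqrt ((b - a) (phi b - phi a)).  Summing over the cylinder intervals of
   level n bounds the bad set by the Hellinger sum of the two Markov chains
   with transition probabilities (p i, 1 - p i) and (q i, 1 - q i); that sum
   obeys a linear recursion in n with matrix entries sqrt (p i q i) and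
   sqrt ((1 - p i) (1 - q i)), and tends to 0 as soon as one row differs.
   When p = q, the same equations contract the distance from phi to the
   identity. *)

(** * Outer measure bounds and the Vitali covering estimate *)

Definition steep (R : realType) (phi : R -> R) (t a b : R) : set R :=
  [set x | exists u v,
    [/\ a <= u < v, v <= b, u <= x <= v & t * (v - u) < phi v - phi u]].

(** Outer measure is bounded through a measurable superset, so that sets such as [steep] and
    [nonflat] can be handled without proving them measurable. *)
Definition outer_le (R : realType) (A : set R) (c : R) : Prop :=
  exists M, [/\ measurable M, A `<=` M & (lebesgue_measure M <= c%:E)%E].

Lemma steep_outer_le (R : realType) (phi : R -> R) (t a b : R) :
  0 < t -> a <= b -> {in `[a, b] &, {homo phi : x y / x <= y}} ->
  outer_le (steep phi t a b) (5 / t * (phi b - phi a)).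
Proof.
move=> t0 ab hphi.
pose I := (R * {posnum R})%type.
have r_gt0 (i : I) : 0 < i.2%:num by [].
pose lo (i : I) := i.1 - i.2%:num.
pose hi (i : I) := i.1 + i.2%:num.
have lohi i : lo i < hi i by rewrite /lo /hi; have r_i := r_gt0 i; lra.
pose V := [set i : I | [/\ a <= lo i, hi i <= b &
  t * (hi i - lo i) < phi (hi i) - phi (lo i)]].
pose B (i : I) := ball i.1 i.2%:num.
have rB i : (radius (B i))%:num = i.2%:num by rewrite radius_ball_num.
have clB i : closure (B i) = `[lo i, hi i]%classic.
  by rewrite -[closure _]/(closed_ball _ _) closed_ball_itv.
(* Vitali's lemma for infinite families requires uniformly bounded radii. *)
have VBr i : V i -> (radius (B i))%:num <= b - a.
  by rewrite rB => -[+ +]; rewrite /lo /hi => *; have r_i := r_gt0 i; lra.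
have B0 i : 0 < (radius (B i))%:num by rewrite rB.
have [D [cD DV tD cov]] := vitali_lemma_infinite (fun i => is_ball_ball _ _) B0 VBr.
have /countable_injP[f finj] := cD.
(* The Vitali family [D] is countable inside an uncountable index type. The injection [f] turns it
   into a sequence of slots, each empty or a singleton, so that measures can be summed over [n]. *)
pose J n := [set i | D i /\ f i = n].
have JP n : J n = set0 \/ exists2 i, D i & J n = [set i].
  have [[i [Di fi]]|nJ] := pselect (exists i, J n i).
    right; exists i => //; apply/seteqP; split => [j [Dj fj]|j ->//].
    by apply: finj; rewrite ?inE// fi fj.
  by left; apply/seteqP; split => // i Ji; apply: nJ; exists i.
pose E n := \bigcup_(i in J n) closed_ball i.1 (5 * i.2%:num).
pose F n := \bigcup_(i in J n) `]phi (lo i), phi (hi i)[%classic.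
have in_ab i : V i -> lo i \in `[a, b] /\ hi i \in `[a, b].
  by case=> h1 h2 _; have := lohi i; rewrite !in_itv/= => *; split; lra.
have mE n : measurable (E n).
  rewrite /E; have [->|[i _ ->]] := JP n; first by rewrite bigcup_set0.
  by rewrite bigcup_set1 closed_ball_itv ?mulr_gt0//.
have mF n : measurable (F n).
  rewrite /F; have [->|[i _ ->]] := JP n; first by rewrite bigcup_set0.
  by rewrite bigcup_set1.
(* Disjoint closed intervals have disjoint open image intervals, so the
   increments of phi are summed as Lebesgue measures of subsets of
   [phi a, phi b]. *)
have tF : trivIset setT F.
  move=> m n _ _ [z [[i [Di fi] zi] [j [Dj fj] zj]]].
  suff ij : i = j by rewrite -fi -fj ij.
  apply: tD => //; rewrite /= !clB.
  have [lo_i hi_i] := in_ab _ (DV _ Di); have [lo_j hi_j] := in_ab _ (DV _ Dj).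
  move: zi zj; rewrite /= !in_itv/= => /andP[z1 z2] /andP[z3 z4].
  (* If one interval lay to the left of the other, monotonicity of [phi] would separate their
     images, which share [z]. So the intervals overlap, and the larger of their left endpoints lies
     in both. *)
  have h1 : lo j <= hi i.
    rewrite leNgt; apply/negP => /ltW/(hphi _ _ hi_i lo_j) h; lra.
  have h2 : lo i <= hi j.
    rewrite leNgt; apply/negP => /ltW/(hphi _ _ hi_j lo_i) h; lra.
  have := lohi i; have := lohi j.
  have [h|h] := leP (lo i) (lo j).
    by exists (lo j); rewrite /= !in_itv/=; split; lra.
  by exists (lo i); rewrite /= !in_itv/=; split; lra.
(* Enlarging fivefold gives length [5 * (hi i - lo i)], and membership in [V] bounds this by [5 / t]
   times the length of the image interval. *)
have EF n : (lebesgue_measure (E n) <= (5 / t)%:E * lebesgue_measure (F n))%E.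
  rewrite /E /F; have [->|[i Di ->]] := JP n.
    by rewrite !bigcup_set0 measure0 mule0.
  have [lo_i hi_i] := in_ab _ (DV _ Di).
  rewrite !bigcup_set1 lebesgue_measure_closed_ball// lebesgue_measure_itv/= lte_fin.
  have [_ _ h] := DV _ Di.
  have phi_lt : phi (lo i) < phi (hi i).
    by rewrite -subr_gt0; apply: lt_trans h; rewrite mulr_gt0// subr_gt0.
  rewrite phi_lt -EFinB -EFinM lee_fin -mulr_natr.
  have : 2 * i.2%:num <= (phi (hi i) - phi (lo i)) / t.
    rewrite ler_pdivlMr// (le_trans _ (ltW h))//.
    by rewrite /hi /lo; lra.
  by lra.
have bF : (lebesgue_measure (\bigcup_n F n) <= (phi b - phi a)%:E)%E.
  have pab : phi a <= phi b by apply: hphi; rewrite ?in_itv/= ?lexx ?ab.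
  apply: (@le_trans _ _ (lebesgue_measure `[phi a, phi b]%classic)).
    apply: le_measure; rewrite ?inE//; first exact: bigcupT_measurable.
    move=> z [n _ [i [Di _]]]; have [lo_i hi_i] := in_ab _ (DV _ Di).
    rewrite /= !in_itv/= => /andP[z1 z2].
    have : phi a <= phi (lo i).
      by apply: hphi => //; rewrite ?in_itv/= ?lexx ?ab//; case: (DV _ Di).
    have : phi (hi i) <= phi b.
      by apply: hphi => //; rewrite ?in_itv/= ?lexx ?ab//; case: (DV _ Di).
    by lra.
  rewrite lebesgue_measure_itv/= lte_fin; case: ifP => // _.
  by rewrite lee_fin subr_ge0.
exists (\bigcup_n E n); split; first exact: bigcupT_measurable.
  move=> x [u [v [/andP[au uv] vb /andP[ux xv] h]]].
  have r0 : 0 < (v - u) / 2 by lra.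
  pose i : I := ((u + v) / 2, PosNum r0).
  have lE : lo i = u by rewrite /lo/=; lra.
  have hE : hi i = v by rewrite /hi/=; lra.
  have Vi : V i by rewrite /V/= lE hE.
  have [j [Dj _ _ cij]] := cov _ Vi.
  exists (f j) => //; exists j => //; rewrite -[_ x]/(closure (ball _ _) x).
  rewrite -scale_ballE//; apply: cij; rewrite clB /= in_itv/= lE hE.
  by rewrite ux xv.
apply: (@le_trans _ _ (\sum_(n <oo) lebesgue_measure (E n))%E).
  by apply: measure_sigma_subadditive => //; exact: bigcupT_measurable.
apply: (@le_trans _ _ (\sum_(n <oo) (5 / t)%:E * lebesgue_measure (F n))%E).
  by apply: lee_nneseries.
rewrite nneseriesZl//.
rewrite [leRHS]EFinM lee_pmul2l// ?lte_fin ?divr_gt0//.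
move: bF; rewrite measure_bigcup//; last by move=> n _; exact: mF.
by rewrite (eq_eseriesl (Q := xpredT))// => n; rewrite in_setT.
Qed.

Lemma outer_leS (R : realType) (A B : set R) (c d : R) :
  A `<=` B -> c <= d -> outer_le B c -> outer_le A d.
Proof.
move=> AB cd [M [mM BM Mc]]; exists M; split => //.
  exact: subset_trans BM.
by rewrite (le_trans Mc)// lee_fin.
Qed.

Lemma outer_leU (R : realType) (A B : set R) (c d : R) :
  outer_le A c -> outer_le B d -> outer_le (A `|` B) (c + d).
Proof.
move=> [M [mM AM Mc]] [N [mN BN Nd]]; exists (M `|` N); split.
- exact: measurableU.
- exact: setUSS.
- by rewrite EFinD (le_trans (measureU2 _ _ _))// leeD.
Qed.

Lemma outer_le_itv (R : realType) (a b : R) :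
  a <= b -> outer_le `[a, b]%classic (b - a).
Proof.
move=> ab; exists `[a, b]%classic; split => //.
rewrite lebesgue_measure_itv/= lte_fin; case: ifP => // _.
by rewrite lee_fin subr_ge0.
Qed.

(** Intersecting supersets of measure at most [1 / (n + 1)] gives one measurable null superset. *)
Lemma outer_le_negligible (R : realType) (A : set R) :
  (forall e, 0 < e -> outer_le A e) -> (@lebesgue_measure R).-negligible A.
Proof.
move=> hA.
have /choice[M hM] : forall n, exists M, [/\ measurable M, A `<=` M &
    (lebesgue_measure M <= (n.+1%:R^-1)%:E)%E].
  by move=> n; apply: hA; rewrite invr_gt0.
have mM : measurable (\bigcap_n M n).
  by apply: bigcap_measurable => // n _; case: (hM n).
exists (\bigcap_n M n); split => //; last by move=> x Ax n _; case: (hM n) => _ + _; exact.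
apply/eqP; rewrite -measure_le0; apply/lee_addgt0Pr => e e0; rewrite add0e.
have [n ne] : exists n, n.+1%:R^-1 < e.
  by exists (Num.truncn e^-1); rewrite invf_plt ?posrE// truncnS_gt.
have [mMn _ Mn] := hM n.
apply: (@le_trans _ _ (lebesgue_measure (M n))).
  by apply: le_measure; rewrite ?inE// => x; exact.
by rewrite (le_trans Mn)// lee_fin ltW.
Qed.

(** * Points at which the derivative fails to vanish *)

Definition nonflat (R : realType) (phi : R -> R) (t : R) : set R :=
  [set x | forall d, 0 < d -> exists2 y, 0 < `|y - x| < d &
    t * `|y - x| < `|phi y - phi x|].

(** Failure of [nonflat] at threshold [1 / (n + 1)] provides a punctured neighbourhood on which
    difference quotients are at most [1 / (n + 1)] in absolute value. *)
Lemma flat_is_derive (R : realType) (phi : R -> R) (x : R) :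
  (forall n : nat, ~ nonflat phi (n.+1%:R^-1) x) -> is_derive x 1 phi 0.
Proof.
move=> hx.
suff h : h^-1 *: (phi (h *: 1 + x) - phi x) @[h --> 0^'] --> (0 : R).
  split; last exact: (@cvg_lim R).
  by apply/cvg_ex; exists 0; exact: h.
apply/cvgrPdist_le => e e0.
have [n ne] : exists n, n.+1%:R^-1 < e.
  by exists (Num.truncn e^-1); rewrite invf_plt ?posrE// truncnS_gt.
have /existsNP[d /not_implyP[d0 hd]] := hx n.
exists d => //= h /=; rewrite sub0r normrN => hd' h0.
rewrite sub0r normrN [_ *: 1]mulr1 normrM normfV.
have h_gt0 : 0 < `|h| by rewrite normr_gt0.
rewrite ler_pdivrMl// mulrC leNgt; apply/negP => bad; apply: hd.
exists (h + x); rewrite addrK ?h_gt0//.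
by rewrite (le_lt_trans _ bad)// ler_pM2r// ltW.
Qed.

Lemma nonflat_sub_steep (R : realType) (phi : R -> R) (t a b : R) :
  {in `[a, b] &, {homo phi : x y / x <= y}} ->
  nonflat phi t `&` `]a, b[ `<=` steep phi t a b.
Proof.
move=> hphi x [hx]; rewrite /= in_itv/= => /andP[ax xb].
(* This radius keeps the witness [y] inside [[a, b]]; [x] and [y] in increasing order then serve as
   [u] and [v]. *)
have [|y /andP[y0 yd] hy] := hx (Num.min (x - a) (b - x)).
  by rewrite lt_min; apply/andP; split; lra.
move: yd y0; rewrite lt_min normr_gt0 subr_eq0 => /andP[].
rewrite !ltr_norml => /andP[h1 _] /andP[_ h2] yx.
have xab : x \in `[a, b] by rewrite in_itv/=; lra.
have yab : y \in `[a, b] by rewrite in_itv/=; lra.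
have [xy|xy] := ltP x y.
  exists x, y; split; [lra|lra|lra|].
  have := hphi _ _ xab yab (ltW xy) => pxy.
  by move: hy; rewrite !ger0_norm ?subr_ge0// ltW.
have {xy} xy : y < x by rewrite lt_neqAle yx.
exists y, x; split; [lra|lra|lra|].
have := hphi _ _ yab xab (ltW xy) => pxy.
by move: hy; rewrite !ler0_norm ?subr_le0// ?opprB// ltW.
Qed.

Lemma nonflat_itv_outer_le (R : realType) (phi : R -> R) (t a b : R) :
  0 < t -> a <= b -> {in `[a, b] &, {homo phi : x y / x <= y}} ->
  outer_le (nonflat phi t `&` `[a, b])
    ((1 + 5 / t) * Num.sqrt ((b - a) * (phi b - phi a))).
Proof.
move=> t0 ab hphi.
have ab0 : 0 <= b - a by rewrite subr_ge0.
have pab : 0 <= phi b - phi a.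
  by rewrite subr_ge0; apply: hphi; rewrite ?in_itv/= ?lexx ?ab.
set s := Num.sqrt _; have s0 : 0 <= s by exact: sqrtr_ge0.
have t5 : 0 < 5 / t by rewrite divr_gt0.
(* The smaller of two nonnegative numbers is at most their geometric mean: the trivial bound is used
   when [b - a] is smaller, the Vitali bound otherwise. *)
have [h|h] := leP (b - a) (phi b - phi a).
  apply: outer_leS (outer_le_itv ab); first exact: subIsetr.
  have bas : b - a <= s.
    by rewrite -[leLHS]ger0_norm// -sqrtr_sqr ler_sqrt ?mulr_ge0// expr2 ler_wpM2l.
  by apply: (le_trans bas); rewrite ler_peMl// lerDl ltW.
have pas : phi b - phi a <= s.
  rewrite -[leLHS]ger0_norm// -sqrtr_sqr ler_sqrt ?mulr_ge0// expr2.
  by rewrite ler_wpM2r// ltW.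
(* At [a] and [b], non-flatness may be witnessed only by points outside [[a, b]], so the endpoints
   are covered separately by intervals of length 0. *)
pose N := `[a, a]%classic `|` `[b, b]%classic `|` steep phi t a b.
apply: (@outer_leS _ _ N _ _ _ _ (outer_leU (outer_leU
  (outer_le_itv (lexx a)) (outer_le_itv (lexx b))) (steep_outer_le t0 ab hphi))).
  move=> x [hx]; rewrite /= in_itv/= => /andP[].
  rewrite le_eqVlt => /orP[/eqP <- _|ax]; first by left; left; rewrite /= in_itv/= lexx.
  rewrite le_eqVlt => /orP[/eqP ->|xb]; first by left; right; rewrite /= in_itv/= lexx.
  by right; apply: nonflat_sub_steep => //; split => //; rewrite /= in_itv/= ax.
rewrite !subrr !add0r; move: (5 / t) t5 => c c0.
by rewrite mulrDl mul1r -[leLHS]add0r lerD// ler_pM2l.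
Qed.

(** * Hellinger sums and substochastic recursions *)

Definition hellinger (R : realType) (phi : R -> R) (s : seq (R * R)) : R :=
  \sum_(u <- s) Num.sqrt ((u.2 - u.1) * (phi u.2 - phi u.1)).

Lemma nonflat_cover_outer_le (R : realType) (phi : R -> R) (t : R)
    (s : seq (R * R)) : 0 < t ->
  {in s, forall u, u.1 <= u.2 /\ {in `[u.1, u.2] &, {homo phi : x y / x <= y}}} ->
  outer_le [set x | nonflat phi t x /\ exists2 u, u \in s & x \in `[u.1, u.2]]
    ((1 + 5 / t) * hellinger phi s).
Proof.
move=> t0; rewrite /hellinger; elim: s => [_|u s ih hs].
  rewrite big_nil mulr0; exists set0; split; [by []| |by rewrite measure0].
  by move=> x [_ []].
have [u12 hu] := hs _ (mem_head _ _).
rewrite big_cons mulrDr.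
apply: outer_leS (lexx _) (outer_leU (nonflat_itv_outer_le t0 u12 hu) (ih _)).
  move=> x [hx [v]]; rewrite inE => /orP[/eqP ->|vs] xv; first by left.
  by right; split => //; exists v.
by move=> v vs; apply: hs; rewrite inE vs orbT.
Qed.

(* The contraction is obtained over two steps, since only one of the two rows
   need be strictly substochastic. *)
Lemma substochastic_bool_to0 (R : realType) (w : bool -> bool -> R)
    (S : nat -> bool -> R) (i0 : bool) :
  (forall i j, 0 < w i j) -> (forall i, w i false + w i true <= 1) ->
  w i0 false + w i0 true < 1 -> (forall i, S 0%N i <= 1) ->
  (forall n i, S n.+1 i = w i false * S n false + w i true * S n true) ->
  forall e, 0 < e -> exists n, forall i, S n i <= e.
Proof.
move=> w0 w1 wi0 S0 SS e e0.
pose rs i := w i false + w i true.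
(* These are the row sums of the squared matrix. Since all entries of [w] are positive, the deficit
   of row [i0] reaches both rows after one step. *)
have rho_lt i : w i false * rs false + w i true * rs true < 1.
  have := w0 i false; have := w0 i true; have := w1 i.
  move: wi0 (w1 false) (w1 true); rewrite -/(rs i0) -/(rs true) -/(rs false).
  by case: i0; nra.
pose rho := Num.max (w false false * rs false + w false true * rs true)
                    (w true false * rs false + w true true * rs true).
have rho1 : rho < 1 by rewrite gt_max !rho_lt.
have rhoE i : w i false * rs false + w i true * rs true <= rho.
  by rewrite le_max; case: i; rewrite lexx ?orbT.
have rho0 : 0 <= rho.
  apply: le_trans (rhoE true).
  by rewrite addr_ge0// mulr_ge0// ?addr_ge0// ltW.
have step n c : 0 <= c -> (forall i, S n i <= c) -> forall i, S n.+2 i <= rho * c.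
  move=> c0 h i; rewrite SS.
  have h1 j : S n.+1 j <= rs j * c.
    by rewrite SS mulrDl lerD// ler_wpM2l// ltW.
  apply: le_trans (ler_wpM2r c0 (rhoE i)).
  by rewrite mulrDl -!mulrA lerD// ler_wpM2l// ltW.
have Srho n : forall i, S n.*2 i <= rho ^+ n.
  elim: n => [|n ih] i; first by rewrite expr0 S0.
  by rewrite doubleS exprS; apply: step => //; rewrite exprn_ge0.
have rho_cvg : (fun n => rho ^+ n) @ \oo --> 0 by apply: cvg_expr; rewrite ger0_norm.
have [N _ hN] := (cvgrPdist_le _ _).1 rho_cvg e e0.
exists N.*2 => i; apply: le_trans (Srho N i) _.
by have := hN N (leqnn N); rewrite /= sub0r normrN ger0_norm// exprn_ge0.
Qed.

(** The vectors [(sqrt x, sqrt (1 - x))] and [(sqrt y, sqrt (1 - y))] have norm 1, so their inner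
    product is 1 minus half their squared distance. *)
Lemma sqrt_affinity_le1 (R : realType) (x y : R) : 0 < x < 1 -> 0 < y < 1 ->
  Num.sqrt (x * y) + Num.sqrt ((1 - x) * (1 - y)) <= 1 ?= iff (x == y).
Proof.
move=> /andP[x0 x1] /andP[y0 y1].
have x0' := ltW x0; have y0' := ltW y0.
have x1' : 0 <= 1 - x by lra.
have y1' : 0 <= 1 - y by lra.
rewrite !sqrtrM//.
have := sqr_sqrtr x0'; have := sqr_sqrtr y0'.
have := sqr_sqrtr x1'; have := sqr_sqrtr y1'.
set a := Num.sqrt x; set b := Num.sqrt y.
set c := Num.sqrt (1 - x); set d := Num.sqrt (1 - y) => hd hc hb ha.
have -> : a * b + c * d = 1 - ((a - b) ^+ 2 + (c - d) ^+ 2) / 2 by nra.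
have ab := sqr_ge0 (a - b); have cd := sqr_ge0 (c - d).
split; first by lra.
apply/eqP/eqP => [h|xy]; last by rewrite /a /b /c /d xy; ring.
have : (a - b) ^+ 2 == 0 by apply/eqP; lra.
by rewrite sqrf_eq0 subr_eq0 => /eqP eq_ab; rewrite -ha -hb eq_ab.
Qed.

#[local] Arguments affine_system : simpl never.

(** * Cylinder intervals and their Hellinger recursion *)

Fixpoint cylinders (R : realType) (f : bool -> bool -> R -> R) (n : nat) (i : bool)
    : seq (R * R) :=
  if n is n'.+1 then
    [seq (f i false u.1, f i false u.2) | u <- cylinders f n' false] ++
    [seq (f i true u.1, f i true u.2) | u <- cylinders f n' true]
  else [:: (0, 1)].

Lemma affine_system_mono (R : realType) (p : bool -> R) i j :
  0 < p i < 1 -> {mono affine_system p i j : x y / x <= y}.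
Proof.
move=> /andP[p0 p1] x y; rewrite /affine_system; case: j.
  by rewrite lerD2r ler_pM2l// subr_gt0.
by rewrite ler_pM2l.
Qed.

Lemma affine_system_itv (R : realType) (p : bool -> R) i j x :
  0 < p i < 1 -> x \in `[0, 1] -> affine_system p i j x \in `[0, 1].
Proof.
move=> /andP[p0 p1]; rewrite !in_itv/= /affine_system => /andP[x0 x1].
by case: j; apply/andP; split; nra.
Qed.

Lemma affine_system_onto (R : realType) (p : bool -> R) i x :
  0 < p i < 1 -> x \in `[0, 1] ->
  exists j, exists2 y, y \in `[0, 1] & x = affine_system p i j y.
Proof.
move=> /andP[p0 p1]; rewrite !in_itv/= => /andP[x0 x1].
have [xp|px] := leP x (p i).
  exists false, (x / p i); last by rewrite /affine_system mulrC divfK ?gt_eqF.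
  by rewrite in_itv/= divr_ge0 ?ler_pdivrMr ?mul1r// ltW.
have q0 : 0 < 1 - p i by lra.
exists true, ((x - p i) / (1 - p i)).
  by rewrite in_itv/= divr_ge0 ?ler_pdivrMr ?mul1r//; lra.
by rewrite /affine_system mulrC divfK ?gt_eqF// subrK.
Qed.

Lemma cylinders_itv (R : realType) (p : bool -> R) n i :
  (forall i, 0 < p i < 1) -> {in cylinders (affine_system p) n i, forall u,
    [/\ u.1 \in `[0, 1], u.2 \in `[0, 1] & u.1 <= u.2]}.
Proof.
move=> hp; elim: n i => [|n ih] i u /=.
  by rewrite inE => /eqP -> /=; rewrite !in_itv/= !lexx !ler01.
rewrite mem_cat => /orP[] /mapP[v /ih[v1 v2 v12] ->] /=;
  by rewrite !affine_system_itv// affine_system_mono.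
Qed.

Lemma cylinders_cover (R : realType) (p : bool -> R) n i x :
  (forall i, 0 < p i < 1) -> x \in `[0, 1] ->
  exists2 u, u \in cylinders (affine_system p) n i & x \in `[u.1, u.2].
Proof.
move=> hp; elim: n i x => [|n ih] i x x01; first by exists (0, 1); rewrite ?inE.
have [j [y y01 ->]] := affine_system_onto (hp i) x01.
have [u us yu] := ih j _ y01.
exists (affine_system p i j u.1, affine_system p i j u.2).
  rewrite /= mem_cat; apply/orP.
  by case: j us {yu} => us; [right|left]; apply/mapP; exists u.
by rewrite in_itv/= !affine_system_mono.
Qed.

(** By conjugacy, applying [f i j] to a cylinder scales its length by the slope of [f i j] and its
    [phi] increment by the slope of [g i j]. The square root of the product of slopes factors
    out. *)
Lemma hellinger_cylindersS (R : realType) (p q : bool -> R) (phi : bool -> R -> R) :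
  (forall i, 0 < p i < 1) -> (forall i, 0 < q i < 1) ->
  conjugacy_solution (affine_system p) (affine_system q) phi ->
  let S n i := hellinger (phi i) (cylinders (affine_system p) n i) in
  forall n i, S n.+1 i = Num.sqrt (p i * q i) * S n false +
     Num.sqrt ((1 - p i) * (1 - q i)) * S n true.
Proof.
move=> hp hq [hphi conj] S n i; rewrite /S /hellinger /= big_cat !big_map !mulr_sumr.
have [/andP[p0 p1] /andP[q0 q1]] := (hp i, hq i).
congr (_ + _); apply: eq_big_seq => u us /=;
  have [u1 u2 u12] := cylinders_itv hp us; rewrite -!conj//.
  rewrite /affine_system -!mulrBr -sqrtrM ?mulr_ge0 ?ltW//.
  by congr Num.sqrt; ring.
rewrite -sqrtrM ?mulr_ge0 ?subr_ge0 ?ltW//.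
by congr Num.sqrt; rewrite /affine_system; ring.
Qed.

Lemma hellinger_cylinders_to0 (R : realType) (p q : bool -> R)
    (phi : bool -> R -> R) (i0 : bool) :
  (forall i, 0 < p i < 1) -> (forall i, 0 < q i < 1) ->
  conjugacy_solution (affine_system p) (affine_system q) phi ->
  p i0 <> q i0 ->
  forall e, 0 < e -> exists n, forall i,
    hellinger (phi i) (cylinders (affine_system p) n i) <= e.
Proof.
move=> hp hq conj pq.
pose w i (j : bool) := if j then Num.sqrt ((1 - p i) * (1 - q i))
                       else Num.sqrt (p i * q i).
apply: (@substochastic_bool_to0 _ w _ i0) => [i j|i|||n i].
- have [/andP[p0 p1] /andP[q0 q1]] := (hp i, hq i).
  by case: j; rewrite sqrtr_gt0 mulr_gt0// subr_gt0.
- by rewrite (sqrt_affinity_le1 (hp i) (hq i)).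
- by rewrite (lt_leif (sqrt_affinity_le1 (hp i0) (hq i0))); apply/eqP.
(* At level 0 the only cylinder is [[0, 1]], over which [phi i] increases by at most 1. *)
- move=> i; rewrite /hellinger big_seq1 subr0 mul1r -[leRHS]sqrtr1 ler_sqrt//.
  have [_ _ im] := conj.1 i.
  have /andP[_ h1] : 0 <= phi i 1 <= 1 by have := im 1; rewrite !in_itv/= lexx ler01; exact.
  have /andP[h0 _] : 0 <= phi i 0 <= 1 by have := im 0; rewrite !in_itv/= lexx ler01; exact.
  lra.
- exact: hellinger_cylindersS.
Qed.

(** * The two cases of the dichotomy *)

Lemma conjugacy_singular (R : realType) (p q : bool -> R)
    (phi : bool -> R -> R) (i0 i : bool) :
  (forall i, 0 < p i < 1) -> (forall i, 0 < q i < 1) ->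
  conjugacy_solution (affine_system p) (affine_system q) phi ->
  p i0 <> q i0 -> singular (phi i).
Proof.
move=> hp hq conj pq.
have [incr _ _] := conj.1 i.
pose N n := nonflat (phi i) n.+1%:R^-1 `&` `]0, 1[.
suff hN n : (@lebesgue_measure R).-negligible (N n).
  apply: negligibleS (negligible_bigcup hN) => x /= /not_implyP[x01 hx].
  apply: contrapT => nN; apply: hx; apply: flat_is_derive => n Nx.
  by apply: nN; exists n.
apply: outer_le_negligible => e e0.
have t0 : 0 < n.+1%:R^-1 :> R by rewrite invr_gt0.
have C0 : 0 < 1 + 5 / n.+1%:R^-1 :> R by rewrite addr_gt0// divr_gt0.
(* The threshold is fixed before the level [m], so the covering constant can be absorbed into the
   target for the Hellinger sum. *)
have [m hm] := hellinger_cylinders_to0 hp hq conj pq (divr_gt0 e0 C0).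
apply: outer_leS _ _ (nonflat_cover_outer_le (phi := phi i)
  (s := cylinders (affine_system p) m i) t0 _).
- move=> x [Nx]; rewrite /= in_itv/= => /andP[x0 x1]; split => //.
  by apply: cylinders_cover; rewrite // in_itv/= !ltW.
- by rewrite mulrC -ler_pdivlMr.
- move=> u us; have [u1 u2 u12] := cylinders_itv hp us; split => // x y xu yu.
  move: xu yu u1 u2; rewrite !in_itv/= => /andP[? ?] /andP[? ?] /andP[? ?] /andP[? ?].
  by apply: incr; rewrite in_itv/=; lra.
Qed.

Lemma conjugacy_id (R : realType) (p : bool -> R) (phi : bool -> R -> R) :
  (forall i, 0 < p i < 1) ->
  conjugacy_solution (affine_system p) (affine_system p) phi ->
  forall i, {in `[0, 1], phi i =1 id}.
Proof.
move=> hp [hphi conj] i x x01.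
(* The largest of the four slopes. *)
pose c := Num.max (Num.max (p false) (1 - p false)) (Num.max (p true) (1 - p true)).
have hc j : p j <= c /\ 1 - p j <= c.
  by rewrite !le_max; case: j; rewrite !lexx ?orbT.
have c0 : 0 <= c by have [h _] := hc true; have := hp true; lra.
have c1 : c < 1 by have := hp true; have := hp false; rewrite !gt_max; lra.
(* Both components are bounded together, since writing [y] as [affine_system p j k z] passes from
   [phi j] to [phi k]. *)
have dist n : forall j y, y \in `[0, 1] -> `|phi j y - y| <= c ^+ n.
  elim: n => [|n ih] j y y01.
    have [_ _ /(_ _ y01)] := hphi j; move: y01; rewrite expr0 !in_itv/= ler_norml.
    by lra.
  have [k [z z01 ->]] := affine_system_onto (hp j) y01.
  rewrite -conj// exprS; have := ih k z z01; have [hc1 hc2] := hc j.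
  have /andP[p0 p1] := hp j.
  have -> : affine_system p j k (phi k z) - affine_system p j k z =
      (if k then 1 - p j else p j) * (phi k z - z).
    by rewrite /affine_system; case: k; ring.
  rewrite normrM => h; apply: ler_pM => //.
  by case: k {h z01}; rewrite ger0_norm//; lra.
apply/eqP; rewrite -subr_eq0 -normr_le0; apply/ler_addgt0Pr => e e0; rewrite add0r.
have c_cvg : (fun n => c ^+ n) @ \oo --> 0 by apply: cvg_expr; rewrite ger0_norm.
have [N _ hN] := (cvgrPdist_le _ _).1 c_cvg e e0.
apply: le_trans (dist N i x x01) _.
by have := hN N (leqnn N); rewrite /= sub0r normrN ger0_norm// exprn_ge0.
Qed.

Theorem theorem3p1 (R : realType) (p q : bool -> R)
    (hp : forall i, 0 < p i < 1) (hq : forall i, 0 < q i < 1)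
    (phi : bool -> R -> R)
    (hphi : conjugacy_solution (affine_system p) (affine_system q) phi) :
  (p false <> q false \/ p true <> q true ->
     singular (phi false) /\ singular (phi true)) /\
  (p false = q false /\ p true = q true ->
     forall (i : bool) (x : R), x \in `[0, 1] -> phi i x = x).
Proof.
split=> [[|] pq|[pq0 pq1] i x x01].
- by split; exact: conjugacy_singular hp hq hphi pq.
- by split; exact: conjugacy_singular hp hq hphi pq.
- have pq : q = p by apply/funext => -[].
  by rewrite pq in hphi; exact: conjugacy_id hp hphi _ _ x01.
Qed.
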